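(* Assume that $F$ satisfies the Pucci structure condition and the $x$-regularity condition (both defined in the context), that $f:\partial\Omega\times\mathbb{R}\to\mathbb{R}$ is continuous and that $r\mapsto f(x,r)$ is non-decreasing on $\mathbb{R}$ for every $x\in\partial\Omega$. Assume moreover that $r\mapsto F(x,r,p,M)$ is non-decreasing on $\mathbb{R}$ for all $(x,p,M)\in\overline{\Omega}\times\mathbb{R}^N\times S(N)$, that $F(x,0,0,0)\ge0$ for all $x\in\Omega$, that $f(x,0)\ge0$ for all $x\in\partial\Omega$, and that $$\max\Big\{\max_{x\in\partial\Omega}f(x,r),\ \max_{x\in\overline{\Omega}}F(x,r,0,0)\Big\}>0\qquad\text{for every } r>0 .$$ If $u\in USC(\overline{\Omega})$ is a viscosity subsolution of $$F(x,u,Du,D^2u)=0\ \text{ in }\Omega,\qquad B(x,u,Du)=0\ \text{ on }\partial\Omega ,$$ then $u\le0$ on $\overline{\Omega}$.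
   Context: Setting. $\Omega\subset\mathbb{R}^N$ is a bounded domain of class $C^2$ with exterior unit normal $\overrightarrow{n}(x)$ at $x\in\partial\Omega$. $S(N)$ is the space of real symmetric $N\times N$ matrices with the usual ordering. $USC(\overline{\Omega})$ is the set of (real-valued) upper semicontinuous functions on $\overline{\Omega}$. $F:\overline{\Omega}\times\mathbb{R}\times\mathbb{R}^N\times S(N)\to\mathbb{R}$ is continuous, and $B(x,r,p)=f(x,r)+\langle p,\overrightarrow{n}(x)\rangle$ for $x\in\partial\Omega$. Pucci operators. For fixed constants $0<a\le A$ and $X\in S(N)$ with eigenvalues $e_1,\dots,e_N$: $\mathcal{M}_{a,A}^+(X)=A\sum_{e_i>0}e_i+a\sum_{e_i<0}e_i$ and $\mathcal{M}_{a,A}^-(X)=a\sum_{e_i>0}e_i+A\sum_{e_i<0}e_i$. Pucci structure condition: there exist $b,c>0$ such that for all $x\in\overline{\Omega}$, $r,s\in\mathbb{R}$, $p,q\in\mathbb{R}^N$, $X,Y\in S(N)$, $$\mathcal{M}_{a,A}^-(Y-X)-b|p-q|-c|r-s|\le F(x,r,p,X)-F(x,s,q,Y)\le\mathcal{M}_{a,A}^+(Y-X)+b|p-q|+c|r-s|.$$ $x$-regularity condition: for each $T>0$ there is a continuous function $\omega_T$ on $[0,\infty)$ with $\omega_T(0)=0$ such that if $X,Y\in S(N)$ and $\zeta>0$ satisfy $$-3\zeta\begin{pmatrix}I&0\\0&I\end{pmatrix}\le\begin{pmatrix}X&0\\0&-Y\end{pmatrix}\le3\zeta\begin{pmatrix}I&-I\\-I&I\end{pmatrix},$$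 then for all $x,y\in\overline{\Omega}$, $r\in[-T,T]$, $p\in\mathbb{R}^N$: $F(y,r,p,Y)-F(x,r,p,X)\le\omega_T(\zeta|x-y|^2+|x-y|(|p|+1))$. Viscosity subsolutions. $u\in USC(\overline{\Omega})$ is a viscosity subsolution of $F(x,u,Du,D^2u)=0$ in $\Omega$, $B(x,u,Du)=0$ on $\partial\Omega$ if, whenever $\varphi\in C^2(\overline{\Omega})$ and $u-\varphi$ has a local maximum at $x_0\in\overline{\Omega}$: (i) if $x_0\in\Omega$, then $F(x_0,u(x_0),D\varphi(x_0),D^2\varphi(x_0))\le0$; (ii) if $x_0\in\partial\Omega$, then $\min\{F(x_0,u(x_0),D\varphi(x_0),D^2\varphi(x_0)),\,B(x_0,u(x_0),D\varphi(x_0))\}\le0$. *)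

(* Defs.v *)
From HB Require Import structures.
From mathcomp Require Import all_boot all_order all_algebra.
From mathcomp Require Import all_classical all_reals all_analysis.

Set Implicit Arguments.
Unset Strict Implicit.
Unset Printing Implicit Defensive.

Import Order.TTheory GRing.Theory Num.Theory.
Import numFieldNormedType.Exports.

Local Open Scope classical_set_scope.
Local Open Scope ring_scope.

(* Vectors of R^N are row vectors. The library norm on 'rV[R]_N is the sup    *)
(* norm: it is used only through the topology and the bounded sets it defines,*)
(* every norm occurring in a formula being the Euclidean norm [enorm].        *)
Definition dotp (R : realType) (N : nat) (p q : 'rV[R]_N) : R :=
  \sum_i p 0 i * q 0 i.

Definition enorm (R : realType) (N : nat) (p : 'rV[R]_N) : R :=
  Num.sqrt (dotp p p).

Definition loewner_le (R : realType) (n : nat) (X Y : 'M[R]_n) : Prop :=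
  forall v : 'rV[R]_n, (v *m X *m v^T) 0 0 <= (v *m Y *m v^T) 0 0.

(* The list of the roots of the characteristic polynomial, repeated according *)
(* to multiplicity. When X is symmetric such a list exists, and it is unique  *)
(* up to reordering.                                                          *)
Definition eigenvalues (R : realType) (n : nat) (X : 'M[R]_n) : seq R :=
  xget [::] [set s : seq R | char_poly X = \prod_(e <- s) ('X - e%:P)].

Definition pucci_plus (R : realType) (n : nat) (a A : R) (X : 'M[R]_n) : R :=
  A * (\sum_(e <- eigenvalues X | 0 < e) e)
  + a * (\sum_(e <- eigenvalues X | e < 0) e).

Definition pucci_minus (R : realType) (n : nat) (a A : R) (X : 'M[R]_n) : R :=
  a * (\sum_(e <- eigenvalues X | 0 < e) e)
  + A * (\sum_(e <- eigenvalues X | e < 0) e).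

Definition basis_vec (R : realType) (N : nat) (i : 'I_N) : 'rV[R]_N :=
  delta_mx 0 i.

Definition partial (R : realType) (N : nat) (phi : 'rV[R]_N -> R) (i : 'I_N)
  (x : 'rV[R]_N) : R := 'D_(basis_vec R i) phi x.

Definition grad (R : realType) (N : nat) (phi : 'rV[R]_N -> R)
  (x : 'rV[R]_N) : 'rV[R]_N := \row_i partial phi i x.

Definition hess (R : realType) (N : nat) (phi : 'rV[R]_N -> R)
  (x : 'rV[R]_N) : 'M[R]_N :=
  \matrix_(i, j) partial (partial phi i) j x.

(* Meant for U open.                                                          *)
Definition C2_on (R : realType) (N : nat) (U : set 'rV[R]_N)
    (phi : 'rV[R]_N -> R) : Prop :=
  [/\ forall x, U x -> {for x, continuous phi},
      forall i x, U x -> derivable phi x (basis_vec R i)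
                         /\ {for x, continuous (partial phi i)}
    & forall i j x, U x -> derivable (partial phi i) x (basis_vec R j)
                         /\ {for x, continuous (partial (partial phi i) j)}].

(* C^2 up to the boundary: phi is C^2 on a neighbourhood of the closure. Only *)
(* the values of phi on the closure matter for its derivatives there, since   *)
(* Omega is open.                                                             *)
Definition C2_closure (R : realType) (N : nat) (Omega : set 'rV[R]_N)
    (phi : 'rV[R]_N -> R) : Prop :=
  exists U : set 'rV[R]_N,
    [/\ open U, closure Omega `<=` U & C2_on U phi].

Definition boundary (T : topologicalType) (Omega : set T) : set T :=
  closure Omega `\` interior Omega.

Definition C2_defining_function (R : realType) (N : nat)
    (Omega : set 'rV[R]_N) (V : set 'rV[R]_N) (rho : 'rV[R]_N -> R) : Prop :=
  [/\ open V, C2_on V rho, forall x, V x -> grad rho x != 0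
    & forall x, V x -> (Omega x <-> rho x < 0)].

Definition bounded_C2_domain (R : realType) (N : nat)
    (Omega : set 'rV[R]_N) : Prop :=
  [/\ Omega !=set0, open Omega, connected Omega, bounded_set Omega
    & forall x, boundary Omega x ->
        exists V rho, V x /\ C2_defining_function Omega V rho].

(* The right-hand side does not depend on the choice of V and rho.            *)
Definition exterior_unit_normal (R : realType) (N : nat)
    (Omega : set 'rV[R]_N) (x nu : 'rV[R]_N) : Prop :=
  exists V rho, [/\ V x, C2_defining_function Omega V rho
    & nu = (enorm (grad rho x))^-1 *: grad rho x].

(* A function on K is represented by a total function, of which only the      *)
(* restriction to K is used; likewise F(x, r, p, X) is only used for x in the *)
(* closure of Omega and X symmetric.                                          *)
Definition usc_on (R : realType) (N : nat) (K : set 'rV[R]_N)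
    (u : 'rV[R]_N -> R) : Prop :=
  forall x, K x -> forall t, u x < t -> \forall y \near within K (nbhs x), u y < t.

Definition local_max_on (R : realType) (N : nat) (K : set 'rV[R]_N)
    (g : 'rV[R]_N -> R) (x0 : 'rV[R]_N) : Prop :=
  K x0 /\ \forall y \near within K (nbhs x0), g y <= g x0.

Definition operator (R : realType) (N : nat) : Type :=
  'rV[R]_N -> R -> 'rV[R]_N -> 'M[R]_N -> R.

Definition operator_continuous (R : realType) (N : nat)
    (Omega : set 'rV[R]_N) (F : operator R N) : Prop :=
  {within [set z : 'rV[R]_N * R * 'rV[R]_N * 'M[R]_N |
             closure Omega z.1.1.1 /\ z.2 \is symmetricmx],
   continuous (fun z : 'rV[R]_N * R * 'rV[R]_N * 'M[R]_N =>
     F z.1.1.1 z.1.1.2 z.1.2 z.2)}.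

Definition pucci_structure (R : realType) (N : nat) (a A : R)
    (Omega : set 'rV[R]_N) (F : operator R N) : Prop :=
  exists b c : R, [/\ 0 < b, 0 < c &
    forall (x : 'rV[R]_N) (r s : R) (p q : 'rV[R]_N) (X Y : 'M[R]_N),
      closure Omega x -> X \is symmetricmx -> Y \is symmetricmx ->
      pucci_minus a A (Y - X) - b * enorm (p - q) - c * `|r - s|
        <= F x r p X - F x s q Y
        <= pucci_plus a A (Y - X) + b * enorm (p - q) + c * `|r - s|].

Definition x_regularity (R : realType) (N : nat)
    (Omega : set 'rV[R]_N) (F : operator R N) : Prop :=
  forall T : R, 0 < T -> exists omega : R -> R,
    [/\ {within [set t : R | 0 <= t], continuous omega}, omega 0 = 0 &
      forall (X Y : 'M[R]_N) (zeta : R),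
        X \is symmetricmx -> Y \is symmetricmx -> 0 < zeta ->
        loewner_le (- (3 * zeta) *: block_mx 1%:M 0 0 1%:M)
                   (block_mx X 0 0 (- Y)) ->
        loewner_le (block_mx X 0 0 (- Y))
                   ((3 * zeta) *: block_mx 1%:M (- 1%:M) (- 1%:M) 1%:M) ->
        forall (x y : 'rV[R]_N) (r : R) (p : 'rV[R]_N),
          closure Omega x -> closure Omega y -> - T <= r <= T ->
          F y r p Y - F x r p X
            <= omega (zeta * enorm (x - y) ^+ 2
                      + enorm (x - y) * (enorm p + 1))].

Definition viscosity_subsolution (R : realType) (N : nat)
    (Omega : set 'rV[R]_N) (F : operator R N)
    (B : 'rV[R]_N -> R -> 'rV[R]_N -> R) (u : 'rV[R]_N -> R) : Prop :=
  usc_on (closure Omega) u /\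
  forall (phi : 'rV[R]_N -> R) (x0 : 'rV[R]_N),
    C2_closure Omega phi ->
    local_max_on (closure Omega) (fun x => u x - phi x) x0 ->
    (Omega x0 -> F x0 (u x0) (grad phi x0) (hess phi x0) <= 0) /\
    (boundary Omega x0 ->
       Num.min (F x0 (u x0) (grad phi x0) (hess phi x0))
               (B x0 (u x0) (grad phi x0)) <= 0).

(* Main.v *)
Require Import Defs.
From HB Require Import structures.
From mathcomp Require Import all_boot all_order all_algebra.
From mathcomp Require Import all_classical all_reals all_analysis.
From mathcomp Require Import ring lra.

Set Implicit Arguments.
Unset Strict Implicit.
Unset Printing Implicit Defensive.

Import Order.TTheory GRing.Theory Num.Theory.
Import numFieldNormedType.Exports.

Local Open Scope classical_set_scope.
Local Open Scope ring_scope.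

(** If u is positive somewhere, it has a positive maximum M, and the strong
    maximum principle shows that u is the constant M; a positive constant is then
    excluded, because one of the two maxima at r = M is positive.

    All test functions are barriers d (q - K q^2), where
    q(x) = |x - y|^2 - |x0 - y|^2 vanishes on a sphere through x0. For large K and
    every d > 0, [strict_barrier] makes them strict supersolutions near x0: where
    u >= 0 one has F(x, u, 0, 0) >= 0, so the Pucci condition reduces everything
    to the extremal operator, whose radial part is dominated by K.

    Strong maximum principle. If a ball in which u < M touches the contact set
    {u = M} at a single point x0, then Hopf's argument [no_max_at_tangent_ball]
    gives a contradiction, x0 being an interior point, or a boundary point with
    the ball inside Omega. At a boundary point this uses f >= 0 and the strict
    normal derivative of the barrier. Hence M is attained in Omega, since
    otherwise the interior tangent ball given by the C^2 regularity could be used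
    at a boundary maximum ([interior_max_exists]); and {u = M} is a neighbourhood
    of each of its points in Omega, since otherwise a ball around a nearby point
    would touch it ([interior_contact]). As Omega is connected and {u = M} is
    closed, u = M on the closure.

    Exclusion of constants. Constant test functions give F(x, M, 0, 0) <= 0 on
    Omega, hence on its closure. At a boundary point with f(x, M) > 0, the barrier
    of the exterior tangent ball has a small gradient but still makes F positive,
    contradicting the boundary condition ([constant_subsolution_boundary_le0]). So
    neither of the two maxima at r = M is positive. *)

(** * Euclidean inner product and rank-one perturbations of scalar matrices *)

Section DotProduct.
Variables (R : realType) (N : nat).
Implicit Types p q : 'rV[R]_N.

Lemma dotpC p q : dotp p q = dotp q p.
Proof. by apply: eq_bigr => i _; rewrite mulrC. Qed.

Lemma dotpDl p1 p2 q : dotp (p1 + p2) q = dotp p1 q + dotp p2 q.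
Proof. by rewrite -big_split; apply: eq_bigr => i _ /=; rewrite mxE mulrDl. Qed.

Lemma dotpDr p q1 q2 : dotp p (q1 + q2) = dotp p q1 + dotp p q2.
Proof. by rewrite dotpC dotpDl !(dotpC p). Qed.

Lemma dotpZl k p q : dotp (k *: p) q = k * dotp p q.
Proof. by rewrite mulr_sumr; apply: eq_bigr => i _; rewrite mxE mulrA. Qed.

Lemma dotpZr k p q : dotp p (k *: q) = k * dotp p q.
Proof. by rewrite dotpC dotpZl dotpC. Qed.

Lemma dotpNr p q : dotp p (- q) = - dotp p q.
Proof. by rewrite -scaleN1r dotpZr mulN1r. Qed.

Lemma dotpNl p q : dotp (- p) q = - dotp p q.
Proof. by rewrite dotpC dotpNr dotpC. Qed.

Lemma dotp_ge0 p : 0 <= dotp p p.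
Proof. by apply: sumr_ge0 => i _; rewrite -expr2 sqr_ge0. Qed.

Lemma dotp_gt0 p : p != 0 -> 0 < dotp p p.
Proof.
move=> p0; rewrite lt_def dotp_ge0 andbT; apply: contraNneq p0 => e0.
apply/eqP/rowP => i; rewrite mxE; apply/eqP.
have /psumr_eq0P : forall j : 'I_N, true -> 0 <= p 0 j * p 0 j.
  by move=> j _; rewrite -expr2 sqr_ge0.
by move=> /(_ e0 i isT)/eqP; rewrite mulf_eq0 orbb.
Qed.

Lemma dotp_sqrD p q :
  dotp (p + q) (p + q) = dotp p p + 2 * dotp p q + dotp q q.
Proof. by rewrite dotpDl !dotpDr (dotpC q p); ring. Qed.

Lemma enorm_ge0 p : 0 <= enorm p.
Proof. exact: sqrtr_ge0. Qed.

Lemma enorm_sqr p : enorm p ^+ 2 = dotp p p.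
Proof. by rewrite sqr_sqrtr // dotp_ge0. Qed.

Lemma enormZ k p : enorm (k *: p) = `|k| * enorm p.
Proof.
rewrite /enorm dotpZl dotpZr mulrA -expr2 sqrtrM ?sqr_ge0 //.
by rewrite sqrtr_sqr.
Qed.

Lemma normr_coord p i : `|p 0 i| <= `|p|.
Proof.
rewrite [leRHS]mx_normrE.
by apply: (le_trans _ (le_bigmax _ _ (0, i))).
Qed.

(** The norm on the left is the sup norm; this inequality lets Euclidean
    estimates control neighbourhoods. *)
Lemma normr_le_enorm_sqr p : `|p| ^+ 2 <= dotp p p.
Proof.
have [->|p0] := eqVneq p 0; first by rewrite normr0 expr0n dotp_ge0.
have /(@mx_norm_neq0 R) [[i j] e] : mx_norm p != 0.
  by apply: contraNneq p0 => /mx_norm_eq0 ->.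
rewrite /= [i]ord1 in e; rewrite [`|p|]e real_normK ?num_real //.
rewrite /dotp (bigD1 j) //= -expr2 lerDl.
by apply: sumr_ge0 => k _; rewrite -expr2 sqr_ge0.
Qed.

End DotProduct.

(** With c = X + s, the bordered matrix with blocks c I, h^T, t h, 1 has two
    block triangular factorizations, which give its determinant as
    det (c I - t h^T h) and, up to the factor c, as c^(m+1) (c - t |h|^2). *)
Lemma char_poly_rank1_perturbation (R : idomainType) (m : nat) (s t : R)
    (h : 'rV[R]_m.+1) :
  char_poly (t *: (h^T *m h) - s%:M) =
  ('X + s%:P) ^+ m * ('X + s%:P - (t * (h *m h^T) 0 0)%:P).
Proof.
set c := 'X + s%:P.
have c0 : c != 0 by rewrite -size_poly_eq0 /c size_XaddC.
pose hp := map_mx polyC h.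
have -> : char_poly (t *: (h^T *m h) - s%:M)
    = \det (c%:M - (t%:P *: (hp^T *m hp))).
  rewrite /char_poly /char_poly_mx; congr (\det _).
  apply/matrixP => i j; rewrite !mxE polyCB polyCM rmorphMn /= rmorph_sum /=.
  rewrite (_ : \sum_(k < 1) (h^T i k * h k j)%:P
      = \sum_(k < 1) hp^T i k * hp k j); last first.
    by apply: eq_bigr => k _; rewrite !mxE polyCM.
  by rewrite /c mulrnDl; ring.
apply: (mulfI c0); set D := c%:M - _.
pose P := block_mx (c%:M : 'M[{poly R}]_m.+1) hp^T (t%:P *: hp)
  (1%:M : 'M[{poly R}]_1).
have detP : \det P = \det D.
  have e : P *m block_mx 1%:M 0 (- (t%:P *: hp)) 1%:M
       = block_mx D hp^T 0 1%:M.
    rewrite /P mulmx_block !mulmx1 !mulmx0 !mul1mx !add0r.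
    rewrite mulmxN -scalemxAr subrr.
    by [].
  have := congr1 (fun M => \det M) e.
  by rewrite det_mulmx det_lblock det_ublock !det1 !mulr1.
rewrite -detP.
have e : block_mx 1%:M 0 (- (t%:P *: hp)) c%:M *m P
    = block_mx c%:M hp^T 0 (c%:M - t%:P *: (hp *m hp^T)).
  rewrite /P mulmx_block !mul1mx !mul0mx !mulmx1 !addr0 mulNmx.
  rewrite mul_mx_scalar mul_scalar_mx addNr mulNmx -scalemxAl.
  by rewrite [- _ + _]addrC.
have := congr1 (fun M => \det M) e.
rewrite det_mulmx det_lblock det_ublock !det_scalar expr1n mul1r expr1.
move=> ->; rewrite exprS -mulrA; congr (_ * (_ * _)).
rewrite det_mx11 !mxE mulr1n; congr (_ - _).
rewrite polyCM rmorph_sum /=; congr (_ * _).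
by apply: eq_bigr => k _; rewrite !mxE polyCM.
Qed.

Lemma eigenvalues_perm (R : realType) (n : nat) (X : 'M[R]_n) (s : seq R) :
  char_poly X = \prod_(e <- s) ('X - e%:P) -> perm_eq (eigenvalues X) s.
Proof.
move=> Xs; apply: prod_XsubC_eq; rewrite -Xs.
by have /(xgetPex [::]) /= <- : exists s : seq R,
  char_poly X = \prod_(e <- s) ('X - e%:P) by exists s.
Qed.

(** The eigenvalues are t |h|^2 - s, once, and -s, m times; the bounds on s
    determine their signs. *)
Lemma pucci_minus_rank1_perturbation (R : realType) (m : nat) (a A s t : R)
    (h : 'rV[R]_m.+1) :
  0 < s -> s < t * dotp h h ->
  pucci_minus a A (t *: (h^T *m h) - s%:M) =
  a * (t * dotp h h - s) - A * (s *+ m).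
Proof.
move=> s0 st.
pose l := rcons (nseq m (- s)) (t * dotp h h - s).
have /eigenvalues_perm El : char_poly (t *: (h^T *m h) - s%:M)
    = \prod_(e <- l) ('X - e%:P).
  rewrite char_poly_rank1_perturbation /l big_rcons /= big_nseq.
  rewrite iter_mulr mulr1.
  congr (_ * _); first by rewrite polyCN opprK.
  have -> : (h *m h^T) 0 0 = dotp h h.
    by rewrite mxE; apply: eq_bigr => i _; rewrite mxE.
  by rewrite polyCB opprB addrA.
rewrite /pucci_minus !(perm_big _ El) /= /l !big_rcons /=.
rewrite subr_gt0 st subr_lt0 ltNge (ltW st) /= !big_nseq_cond oppr_gt0 oppr_lt0.
rewrite s0 ltNge (ltW s0) /= iter_addr addr0.
by rewrite addr0 ?add0r mulNrn mulrN.
Qed.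

(** * The barrier and its derivatives *)

Lemma symmetricmx0 (R : realType) (N : nat) : (0 : 'M[R]_N) \is symmetricmx.
Proof. by apply/is_hermitianmxP; rewrite expr0 scale1r map_mx_id // trmx0. Qed.

Section Barrier.
Variables (R : realType) (N : nat).
Implicit Types x y v : 'rV[R]_N.

Lemma is_derive_coord x v j : is_derive x v (fun z : 'rV[R]_N => z 0 j) (v 0 j).
Proof.
have e : (fun h : R => h^-1 *: (((fun z : 'rV[R]_N => z 0 j) \o shift x) (h *: v)
      - x 0 j)) @ 0^' --> v 0 j.
  apply: cvg_near_cst; near=> h.
  have h0 : h != 0 by near: h; exact: nbhs_dnbhs_neq.
  by rewrite /= !mxE addrK /GRing.scale /= mulKf.
by split; [apply: cvgP e|apply/cvg_lim].
Unshelve. all: by end_near. Qed.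

(** Squared distance to y, shifted to vanish on the sphere of centre y and
    squared radius E. Being polynomial, it has explicit derivatives, and its sign
    tells the inside of the sphere from the outside. *)
Definition sphere_fun y (E : R) x : R := dotp (x - y) (x - y) - E.

(** Where q = sphere_fun y E is small, the barrier has the sign of q and a
    gradient close to that of d q, while the correction - K q^2 makes the second
    derivative in the radial direction as negative as desired. *)
Definition barrier y (E d K : R) x : R :=
  d * (sphere_fun y E x - K * sphere_fun y E x ^+ 2).

Lemma is_derive_shift_coord y x v j :
  is_derive x v (fun z : 'rV[R]_N => (z - y) 0 j) (v 0 j).
Proof.
have -> : (fun z : 'rV[R]_N => (z - y) 0 j)
    = (fun z : 'rV[R]_N => z 0 j) - cst (y 0 j).
  by apply/funext => z; rewrite !mxE.
have := is_deriveB (is_derive_coord x v j) (is_derive_cst (y 0 j) x v).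
by rewrite subr0.
Qed.

Lemma is_derive_sphere_fun y E x v :
  is_derive x v (sphere_fun y E) (2 * dotp (x - y) v).
Proof.
pose c j := fun z : 'rV[R]_N => (z - y) 0 j.
have -> : sphere_fun y E = \sum_j (c j * c j) - cst E.
  apply/funext => z; rewrite /sphere_fun /dotp.
  rewrite -[RHS]/((\sum_j (c j * c j)) z - E).
  by rewrite fct_sumE.
have c' j : is_derive x v (c j) (v 0 j) by exact: is_derive_shift_coord.
apply: is_derive_eq; rewrite subr0 /dotp mulr_sumr.
by apply: eq_bigr => j _; rewrite /c /GRing.scale /=; ring.
Qed.

Lemma continuous_shift_coord y i : continuous (fun z : 'rV[R]_N => (z - y) 0 i).
Proof.
have -> : (fun z : 'rV[R]_N => (z - y) 0 i)
    = (fun z : 'rV[R]_N => z 0 i) - cst (y 0 i).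
  by apply/funext => z; rewrite !mxE.
move=> x; apply: continuousB; first exact: coord_continuous.
exact: cst_continuous.
Qed.

Lemma continuous_sphere_fun y E : continuous (sphere_fun y E).
Proof.
have -> : sphere_fun y E = (fun z => dotp (z - y) (z - y)) - cst E by [].
move=> x; apply: continuousB; last exact: cst_continuous.
apply: (@continuous_big R 'I_N +%R 0 xpredT) => [|i _ z].
  exact: add_continuous.
by apply: continuousM; exact: continuous_shift_coord.
Qed.

Lemma continuous_barrier y E d K : continuous (barrier y E d K).
Proof.
move=> x; set q := sphere_fun y E.
have -> : barrier y E d K = cst d \* (q - cst K \* (q \* q)).
  by apply/funext => z; rewrite /barrier -/q expr2.
have cq : {for x, continuous q} by exact: continuous_sphere_fun.
apply: continuousM; first exact: cst_continuous.
apply: continuousB => //; apply: continuousM; first exact: cst_continuous.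
exact: continuousM.
Qed.

Lemma dotp_basis_vec x i : dotp x (basis_vec R i) = x 0 i.
Proof.
rewrite /dotp (bigD1 i) //= big1 => [|j ji]; first by rewrite mxE !eqxx mulr1 addr0.
by rewrite !mxE (negbTE ji) andbF mulr0.
Qed.

Lemma is_derive_barrier y E d K x v :
  is_derive x v (barrier y E d K)
    (2 * d * (1 - 2 * K * sphere_fun y E x) * dotp (x - y) v).
Proof.
set q := sphere_fun y E.
have q' : is_derive x v q (2 * dotp (x - y) v) by exact: is_derive_sphere_fun.
have -> : barrier y E d K = d \*: (q - K \*: (q * q)).
  by apply/funext => z; rewrite /barrier -/q expr2.
by apply: is_derive_eq; rewrite /GRing.scale /=; ring.
Qed.

Lemma partial_barrier y E d K i :
  partial (barrier y E d K) i =
  fun x => 2 * d * (1 - 2 * K * sphere_fun y E x) * (x - y) 0 i.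
Proof.
apply/funext => x; rewrite /partial.
by rewrite (@derive_val _ _ _ _ _ _ _ (is_derive_barrier _ _ _ _ _ _))
  dotp_basis_vec.
Qed.

Lemma is_derive_partial_barrier y E d K i x v :
  is_derive x v (partial (barrier y E d K) i)
    (2 * d * ((1 - 2 * K * sphere_fun y E x) * v 0 i
              - 4 * K * dotp (x - y) v * (x - y) 0 i)).
Proof.
set q := sphere_fun y E; set c := fun z : 'rV[R]_N => (z - y) 0 i.
have q' : is_derive x v q (2 * dotp (x - y) v) by exact: is_derive_sphere_fun.
have c' : is_derive x v c (v 0 i) by exact: is_derive_shift_coord.
have -> : partial (barrier y E d K) i =
    ((2 * d) \*: (cst 1 - (2 * K) \*: q)) * c.
  by rewrite partial_barrier; apply/funext => z.
apply: is_derive_eq; rewrite /GRing.scale /= -/(c x).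
rewrite [X in X * v 0 i + _](_ : _ = 2 * d * (1 - 2 * K * q x)) //; ring.
Qed.

Lemma partial_partial_barrier y E d K i j :
  partial (partial (barrier y E d K) i) j =
  fun x => 2 * d * ((1 - 2 * K * sphere_fun y E x) * (i == j)%:R
                    - 4 * K * (x - y) 0 j * (x - y) 0 i).
Proof.
apply/funext => x; rewrite {1}/partial.
rewrite (@derive_val _ _ _ _ _ _ _ (is_derive_partial_barrier _ _ _ _ _ _ _)).
by rewrite dotp_basis_vec mxE eqxx.
Qed.

Lemma grad_barrier y E d K x :
  grad (barrier y E d K) x =
  (2 * d * (1 - 2 * K * sphere_fun y E x)) *: (x - y).
Proof. by apply/rowP => i; rewrite mxE partial_barrier [RHS]mxE. Qed.

Lemma hess_barrier y E d K x :
  hess (barrier y E d K) x =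
  (2 * d * (1 - 2 * K * sphere_fun y E x))%:M
  - (8 * d * K) *: ((x - y)^T *m (x - y)).
Proof.
apply/matrixP => i j; rewrite mxE partial_partial_barrier.
rewrite !mxE big_ord1 !mxE.
by case: (i == j); rewrite ?mulr1n ?mulr0n; ring.
Qed.

Lemma hess_barrier_sym y E d K x : hess (barrier y E d K) x \is symmetricmx.
Proof.
apply/is_hermitianmxP; rewrite expr0 scale1r map_mx_id // hess_barrier.
move: (x - y) => h; rewrite linearB /= tr_scalar_mx.
have tr_hh k : (k *: (h^T *m h))^T = k *: (h^T *m h).
  by rewrite linearZ /= trmx_mul trmxK.
by rewrite tr_hh.
Qed.

Lemma C2_barrier (Omega : set 'rV[R]_N) y E d K :
  C2_closure Omega (barrier y E d K).
Proof.
have cq : continuous (fun z : 'rV[R]_N => 1 - 2 * K * sphere_fun y E z).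
  have -> : (fun z : 'rV[R]_N => 1 - 2 * K * sphere_fun y E z)
    = cst 1 - cst (2 * K) \* sphere_fun y E by [].
  move=> z; apply: continuousB; first exact: cst_continuous.
  apply: continuousM; first exact: cst_continuous.
  exact: continuous_sphere_fun.
exists setT; split => //; first exact: openT.
split=> [x _|i x _|i j x _]; first exact: continuous_barrier.
- split; first by have [] := is_derive_barrier y E d K x (basis_vec R i).
  rewrite partial_barrier.
  apply: continuousM; last exact: continuous_shift_coord.
  by apply: continuousM; [exact: cst_continuous|exact: cq].
- split.
    by have [] := is_derive_partial_barrier y E d K i x (basis_vec R j).
  rewrite partial_partial_barrier.
  apply: continuousM; first exact: cst_continuous.
  rewrite -[X in {for _, continuous X}]/(
    (fun z => (1 - 2 * K * sphere_fun y E z) * (i == j)%:R) -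
    (fun z => 4 * K * (z - y) 0 j * (z - y) 0 i)).
  apply: continuousB.
    by apply: continuousM; [exact: cq|exact: cst_continuous].
  apply: continuousM; last exact: continuous_shift_coord.
  apply: continuousM; last exact: continuous_shift_coord.
  exact: cst_continuous.
Qed.

End Barrier.

(** * The barrier is a strict supersolution *)

Lemma sphere_fun_center (R : realType) (N : nat) (x0 y : 'rV[R]_N) :
  sphere_fun y (dotp (x0 - y) (x0 - y)) x0 = 0.
Proof. exact: subrr. Qed.

Lemma near_sphere_fun (R : realType) (N : nat) (x0 y : 'rV[R]_N) (e : R) :
  0 < e -> \forall x \near x0, `|sphere_fun y (dotp (x0 - y) (x0 - y)) x| <= e.
Proof.
move=> e0; have /cvgrPdist_le/(_ _ e0) :=
  @continuous_sphere_fun R N y (dotp (x0 - y) (x0 - y)) x0.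
rewrite sphere_fun_center.
by apply: filterS => x; rewrite sub0r normrN.
Qed.

(** The Pucci condition, used between the jets (p, X) and (0, 0), bounds the
    increment of F below by M^-(-X) - b |p|. Here - X is the matrix
    8 d K h^T h - s I with h = x - y and s between d and 3 d: its radial
    eigenvalue, of order d K |h|^2, enters with the factor a and beats the other
    terms, all of order d, when K is large. All terms are linear in d, so K does
    not depend on d; a small d can then be chosen afterwards. *)
Lemma strict_barrier (R : realType) (m : nat) (a A : R)
    (Omega : set 'rV[R]_m.+1) (F : operator R m.+1) (x0 y : 'rV[R]_m.+1) :
  0 < a -> a <= A -> pucci_structure a A Omega F -> x0 != y ->
  let E := dotp (x0 - y) (x0 - y) in
  exists K, 0 < K /\ \forall x \near x0,
    K * `|sphere_fun y E x| <= 4^-1 /\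
    forall d r, 0 < d -> closure Omega x ->
      F x r 0 0 < F x r (grad (barrier y E d K) x) (hess (barrier y E d K) x).
Proof.
move=> a0 aA [b [c [b0 c0 HF]]] x0y E.
have E0 : 0 < E by apply: dotp_gt0; rewrite subr_eq0.
have A0 : 0 < A by exact: lt_le_trans aA.
(* Near x0 the terms to be absorbed amount to at most 3 d S, since |h| is at
   most twice its value at x0. *)
pose S := a + A * m%:R + 2 * b * Num.sqrt E.
have S_ge : a <= S.
  rewrite /S -addrA lerDl addr_ge0 // ?mulr_ge0 ?sqrtr_ge0 // ltW //.
pose K := S / (a * E).
have S0 : 0 < S by exact: lt_le_trans S_ge.
have K0 : 0 < K by rewrite divr_gt0 // mulr_gt0.
have KE : a * K * E = S by rewrite /K; field; rewrite !gt_eqF.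
(* The first bound on q keeps |h|^2 between E / 2 and 3 E / 2, the second one keeps
   1 - 2 K q between 1 / 2 and 3 / 2. *)
exists K; split=> //; near=> x.
have q1 : `|sphere_fun y E x| <= E / 2.
  by near: x; apply: near_sphere_fun; rewrite divr_gt0.
have q2 : `|sphere_fun y E x| <= (4 * K)^-1.
  by near: x; apply: near_sphere_fun; rewrite invr_gt0 mulr_gt0.
set q := sphere_fun y E x in q1 q2 *.
have Kq : K * `|q| <= 4^-1.
  by rewrite mulrC -ler_pdivlMr // -invfM.
split=> // d r d0 cx.
have Kq' : `|K * q| <= 4^-1 by rewrite normrM gtr0_norm.
have qE : E + q = dotp (x - y) (x - y) by rewrite /q /sphere_fun addrC subrK.
set h := x - y in qE.
have := HF x r r (grad (barrier y E d K) x) 0 (hess (barrier y E d K) x) 0 cx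
  (hess_barrier_sym _ _ _ _ _).
move=> /(_ (symmetricmx0 _ _))/andP[+ _].
rewrite grad_barrier hess_barrier sub0r opprB !subr0 subrr normr0 mulr0 subr0.
rewrite -/q -/h.
set s := 2 * d * (1 - 2 * K * q).
have [s1 s2] : d <= s /\ s <= 3 * d.
  move: Kq'; rewrite ler_norml => /andP[k1 k2].
  rewrite /s; split; nra.
have s0 : 0 < s by exact: lt_le_trans s1.
have hh1 : E / 2 <= dotp h h.
  by move: q1; rewrite ler_norml -qE => /andP[q3 q4]; lra.
have hh2 : enorm h <= 2 * Num.sqrt E.
  rewrite -(@ler_pXn2r _ 2) ?nnegrE ?enorm_ge0 ?mulr_ge0 ?sqrtr_ge0 //.
  rewrite enorm_sqr exprMn sqr_sqrtr ?ltW // -qE.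
  by move: q1; rewrite ler_norml => /andP[q3 q4]; lra.
have main : 4 * d * S <= a * (8 * d * K * dotp h h).
  rewrite -KE (_ : a * (8 * d * K * _) = 8 * d * (a * K) * dotp h h); last by ring.
  have := mulr_gt0 d0 (mulr_gt0 a0 K0).
  move=> z0; have : d * (a * K) * (E / 2) <= d * (a * K) * dotp h h.
    by rewrite ler_pM2l.
  lra.
have st : s < 8 * d * K * dotp h h.
  rewrite -(ltr_pM2l a0); apply: lt_le_trans main.
  have : a * d <= d * S by rewrite mulrC ler_pM2l.
  have : a * s <= a * (3 * d) by rewrite ler_pM2l.
  have : 0 < a * d by rewrite mulr_gt0.
  lra.
rewrite pucci_minus_rank1_perturbation // enormZ gtr0_norm //.
rewrite -subr_gt0 => /(lt_le_trans _); apply.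
rewrite !subr_gt0 -[s *+ m]mulr_natr mulrBr.
have h1 : s * S <= 3 * d * S by rewrite ler_pM2r.
have h2 : b * (s * enorm h) <= b * (s * (2 * Num.sqrt E)) by rewrite !ler_pM2l.
have h3 : 0 < d * S by rewrite mulr_gt0.
have h4 : s * S = a * s + A * (s * m%:R) + b * (s * (2 * Num.sqrt E)).
  by rewrite /S; ring.
lra.
Unshelve. all: by end_near. Qed.

(** * Upper semicontinuous functions on compact sets *)

Lemma subset_near_closed_ball (R : realType) (N : nat) (x0 : 'rV[R]_N)
    (P : set 'rV[R]_N) :
  (\forall x \near x0, P x) ->
  exists2 r, 0 < r & forall x, `|x - x0| <= r -> P x.
Proof.
move=> /nbhs_normP[e /= e0 He]; exists (e / 2); first by rewrite divr_gt0.
move=> x xr; apply: He => /=; rewrite distrC (le_lt_trans xr) //.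
by rewrite ltr_pdivrMr // ltr_pMr // ltr1n.
Qed.

Lemma closed_ball_closed (R : realType) (N : nat) (x0 : 'rV[R]_N) (r : R) :
  closed [set x | `|x - x0| <= r].
Proof.
have -> : [set x : 'rV[R]_N | `|x - x0| <= r]
    = closed_ball_ (fun x => `|x|) x0 r.
  by apply/seteqP; split=> x /=; rewrite distrC.
exact: closed_closed_ball_.
Qed.

Lemma compact_closure (R : realType) (N : nat) (A : set 'rV[R]_N) :
  bounded_set A -> compact (closure A).
Proof.
move=> [M [Mreal bM]].
apply: bounded_closed_compact; last exact: closed_closure.
exists M; split=> // r /bM Ar x clx.
have Ar' : A `<=` [set x | `|x - 0| <= r] by move=> z /Ar /=; rewrite subr0.
suff : [set x : 'rV[R]_N | `|x - 0| <= r] x by rewrite /= subr0.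
rewrite [X in X x](closure_id _).1; last exact: closed_ball_closed.
exact: closureS clx.
Qed.

Lemma usc_on_subset (R : realType) (N : nat) (K K' : set 'rV[R]_N)
    (u : 'rV[R]_N -> R) :
  K' `<=` K -> usc_on K u -> usc_on K' u.
Proof.
move=> sK uK x /sK Kx t ux; have := uK _ Kx _ ux.
by rewrite !near_withinE; apply: filterS => y + /sK; apply.
Qed.

Lemma usc_on_subr (R : realType) (N : nat) (K : set 'rV[R]_N)
    (u g : 'rV[R]_N -> R) :
  usc_on K u -> continuous g -> usc_on K (fun x => u x - g x).
Proof.
move=> uK cg x Kx t; rewrite -subr_gt0 => e0.
set e := t - _ in e0.
have e2 : 0 < e / 2 by rewrite divr_gt0.
have ux : u x < u x + e / 2 by rewrite ltrDl.
have := uK x Kx _ ux; rewrite !near_withinE.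
have /cvgrPdist_lt/(_ _ e2) := cg x.
apply: filterS2 => y; rewrite ltr_norml => /andP[_ gy] uy /uy.
by move: gy; rewrite /e; lra.
Qed.

(** If the supremum is not attained, the superlevel sets form a filter base on
    K; at a cluster point p, upper semicontinuity keeps u below u z near p for
    any z with u p < u z, so that p is not adherent to the superlevel set of z. *)
Lemma usc_on_max (R : realType) (N : nat) (K : set 'rV[R]_N)
    (u : 'rV[R]_N -> R) :
  compact K -> K !=set0 -> usc_on K u ->
  exists2 x, K x & forall y, K y -> u y <= u x.
Proof.
move=> cK [k Kk] uK; apply: contrapT => noM.
have lt_u x : K x -> exists2 y, K y & u x < u y.
  move=> Kx; apply: contrapT => nolt; apply: noM; exists x => // y Ky.
  by rewrite leNgt; apply/negP => xy; apply: nolt; exists y.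
pose G : set_system 'rV[R]_N :=
  [set P | exists2 z, K z & forall x, K x -> u z <= u x -> P x].
have GF : ProperFilter G.
  split; first by move=> [z Kz /(_ z Kz (lexx _))].
  split=> [|P Q [z Kz zP] [w Kw wQ]|P Q PQ [z Kz zP]].
  - by exists k.
  - have [zw|wz] := leP (u z) (u w).
      exists w => // x Kx wx; split; last exact: wQ.
      by apply: zP => //; exact: le_trans zw wx.
    exists z => // x Kx zx; split; first exact: zP.
    by apply: wQ => //; exact: le_trans (ltW wz) zx.
  - by exists z => // x Kx zx; apply/PQ/zP.
have [|p [Kp Gp]] := cK G GF; first by exists k.
have [z Kz pz] := lt_u _ Kp.
have [|x [[Kx zx] /(_ Kx)]] := Gp [set x | K x /\ u z <= u x] _ _ (uK _ Kp _ pz).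
  by exists z.
by rewrite ltNge zx.
Qed.

(** * Second-order Taylor bound from partial derivatives *)

Lemma norm_rV_le (R : realType) (N : nat) (v : 'rV[R]_N) (r : R) :
  0 <= r -> (forall i, `|v 0 i| <= r) -> `|v| <= r.
Proof.
move=> r0 vr; rewrite [leLHS]mx_normrE; apply: bigmax_le => // -[i j] _ /=.
by rewrite ord1.
Qed.

Section Taylor.
Context (R : realType) (N : nat).
Implicit Types (g : 'rV[R]_N -> R) (x : 'rV[R]_N).

Lemma is_derive_line g x i (s : R) :
  derivable g (x + s *: basis_vec R i) (basis_vec R i) ->
  is_derive s 1 (fun t => g (x + t *: basis_vec R i))
    (partial g i (x + s *: basis_vec R i)).
Proof.
set e := basis_vec R i; rewrite /derivable.
set q := (X in cvg (X @ _)) => dg.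
have -> : partial g i (x + s *: e) = lim (q @ 0^') by [].
have eq_q : (fun h : R => h^-1 *: (((fun t => g (x + t *: e)) \o shift s) (h *: 1)
    - g (x + s *: e))) = q.
  apply/funext => h; rewrite /q /= [h *: 1]mulr1; congr (_ *: (g _ - _)).
  by rewrite scalerDl addrCA.
by split; rewrite /derivable /derive eq_q.
Qed.

Lemma partial_bound_line g x i (h C : R) :
  (forall s : R, `|s| <= `|h| -> derivable g (x + s *: basis_vec R i) (basis_vec R i)
     /\ `|partial g i (x + s *: basis_vec R i)| <= C) ->
  `|g (x + h *: basis_vec R i) - g x| <= C * `|h|.
Proof.
set e := basis_vec R i => Hg.
pose G t := g (x + t *: e); pose G' t := partial g i (x + t *: e).
have G0 : G 0 = g x by rewrite /G scale0r addr0.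
have dG (s : R) : `|s| <= `|h| -> is_derive s 1 G (G' s).
  by move=> /Hg[dg _]; exact: is_derive_line.
have cG (I : interval R) : {in I, forall s : R, `|s| <= `|h|} ->
    {within [set` I], continuous G}.
  move=> Ih; apply: derivable_within_continuous => s /Ih /dG.
  by case.
rewrite -[g x]G0 -/(G h); have [h0|h0] := leP 0 h.
  have Ih : {in `[0, h], forall s : R, `|s| <= `|h|}.
    by move=> s; rewrite in_itv /= => /andP[s0 sh]; rewrite !ger0_norm.
  have [|s sI ->] := @MVT_segment R G G' 0 h h0 _ (cG _ Ih).
    by move=> s sI; apply/dG/Ih/subset_itv_oo_cc.
  by rewrite subr0 normrM ler_wpM2r //; have [_] := Hg _ (Ih _ sI).
have Ih : {in `[h, 0], forall s : R, `|s| <= `|h|}.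
  move=> s; rewrite in_itv /= => /andP[s0 sh].
  by rewrite !ler0_norm ?lerN2 // ltW.
have [|s sI] := @MVT_segment R G G' h 0 (ltW h0) _ (cG _ Ih).
  by move=> s sI; apply/dG/Ih/subset_itv_oo_cc.
rewrite sub0r distrC => ->.
by rewrite normrM normrN ler_wpM2r //; have [_] := Hg _ (Ih _ sI).
Qed.

(** Moving from x0 to x one coordinate at a time stays in the sup-norm ball, so
    the one-variable mean value theorem bounds each of the N increments. *)
Lemma partial_bound_lipschitz g x0 (r C : R) : 0 <= C ->
  (forall z i, `|z - x0| <= r ->
     derivable g z (basis_vec R i) /\ `|partial g i z| <= C) ->
  forall x, `|x - x0| <= r -> `|g x - g x0| <= N%:R * C * `|x - x0|.
Proof.
move=> C0 Hg x xr.
(* The first k coordinates have been moved from x0 to x. *)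
pose p k : 'rV[R]_N := \row_j (if (j < k)%N then x 0 j else x0 0 j).
have pN : p N = x by apply/rowP => j; rewrite mxE ltn_ord.
have p0 : p 0%N = x0 by apply/rowP => j; rewrite mxE.
suff H k : (k <= N)%N -> `|g (p k) - g x0| <= k%:R * C * `|x - x0|.
  by rewrite -{1}pN; apply: H.
elim: k => [_|k IHk kN]; first by rewrite p0 subrr normr0 !mul0r.
pose i := Ordinal kN.
have pS : p k.+1 = p k + (x 0 i - x0 0 i) *: basis_vec R i.
  apply/rowP => j; rewrite !mxE eqxx /= ltnS leq_eqVlt.
  have [->|ji] := eqVneq j i; first by rewrite /= eqxx ltnn mulr1 addrC subrK.
  by rewrite mulr0 addr0 (_ : (j == k :> nat) = false) //; exact/negbTE.
rewrite (_ : _ - _ = (g (p k.+1) - g (p k)) + (g (p k) - g x0)); last first.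
  by rewrite addrA subrK.
rewrite (le_trans (ler_normD _ _)) // -natr1 [leRHS](_ : _ =
  C * `|x - x0| + k%:R * C * `|x - x0|); last by ring.
rewrite lerD ?IHk ?(ltnW kN) //.
have xi : `|x 0 i - x0 0 i| <= `|x - x0|.
  by have := normr_coord (x - x0) i; rewrite !mxE.
rewrite pS (@le_trans _ _ (C * `|x 0 i - x0 0 i|)) ?ler_wpM2l //.
apply: partial_bound_line => s sh; apply: Hg; apply: le_trans xr.
apply: norm_rV_le => // j; rewrite !mxE eqxx /=.
have [->|ji] := eqVneq j i.
  by rewrite ltnn mulr1 addrC addKr (le_trans sh).
rewrite mulr0 addr0; case: ifP => _; last by rewrite subrr normr0.
by have := normr_coord (x - x0) j; rewrite !mxE.
Qed.

Lemma is_derive_dotp (w x v : 'rV[R]_N) : is_derive x v (dotp w) (dotp w v).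
Proof.
pose c j := fun z : 'rV[R]_N => z 0 j.
have e : dotp w = \sum_j (w 0 j \*: c j).
  by apply/funext => z; rewrite fct_sumE.
have c' j : is_derive x v (c j) (v 0 j) by exact: is_derive_coord.
by rewrite [X in is_derive x v X _]e; apply: is_derive_eq.
Qed.

(** The Lipschitz bound is used twice: for the first partial derivatives, which
    differ from their values at x0 by at most N C0 |x - x0|, and then for g minus
    its linear part, whose partial derivatives are these differences. *)
Lemma taylor_bound (V : set 'rV[R]_N) g x0 : open V -> C2_on V g -> V x0 ->
  exists2 C, 0 <= C & \forall x \near x0,
    `|g x - g x0 - dotp (grad g x0) (x - x0)| <= C * dotp (x - x0) (x - x0).
Proof.
move=> oV [_ dg ddg] Vx0.
pose C0 := \sum_i \sum_j (`|partial (partial g i) j x0| + 1).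
have C00 : 0 <= C0.
  by apply: sumr_ge0 => i _; apply: sumr_ge0 => j _; rewrite addr_ge0.
pose Q i j x := `|partial (partial g i) j x| <= C0.
have nearQ : \forall x \near x0, forall i j, Q i j x.
  apply: (@filter_forall _ _ (fun i x => forall j, Q i j x) (nbhs x0)) => i.
  apply: (@filter_forall _ _ (Q i) (nbhs x0)) => j.
  have [_ /cvgrPdist_le/(_ _ ltr01)] := ddg i j x0 Vx0.
  apply: filterS => x d1.
  apply: (@le_trans _ _ (`|partial (partial g i) j x0| + 1)).
    rewrite -lerBlDl; apply: le_trans d1.
    by rewrite distrC; exact: lerB_dist.
  have T0 k l : 0 <= `|partial (partial g k) l x0| + 1 by rewrite addr_ge0.
  have term_le (I : finType) (T : I -> R) k : (forall k, 0 <= T k) -> T k <= \sum_k T k.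
    by move=> ?; rewrite (bigD1 k) //= lerDl sumr_ge0.
  apply: le_trans (term_le _ _ j (T0 i)) _.
  by apply: (term_le _ (fun k => \sum_l _) i) => k; exact: sumr_ge0.
have [r r0 Hr] := subset_near_closed_ball
  (filterI (open_nbhs_nbhs (conj oV Vx0)) nearQ).
exists (N%:R * (N%:R * C0)); first by rewrite !mulr_ge0.
near=> x.
have xr : `|x - x0| <= r.
  near: x; have := nbhsx_ballx x0 r r0; apply: filterS => z.
  by rewrite mx_norm_ball /ball_ /= distrC => /ltW.
pose w := grad g x0; pose G := g - dotp w.
have G' z i : `|z - x0| <= r ->
    is_derive z (basis_vec R i) G (partial g i z - partial g i x0).
  move=> /Hr[Vz _]; have [dgz _] := dg i z Vz.
  have g' : is_derive z (basis_vec R i) g (partial g i z) by split.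
  have l' := is_derive_dotp w z (basis_vec R i).
  by apply: is_derive_eq; rewrite dotp_basis_vec mxE.
have GL : `|G x - G x0| <= N%:R * (N%:R * C0 * `|x - x0|) * `|x - x0|.
  apply: (@partial_bound_lipschitz G x0 `|x - x0|) => //.
    by rewrite !mulr_ge0.
  move=> z i zx; have zr := le_trans zx xr.
  have Gz := G' z i zr; split; first by case: Gz.
  rewrite {1}/partial (@derive_val _ _ _ _ _ _ _ Gz).
  apply: le_trans (_ : N%:R * C0 * `|z - x0| <= _); last first.
    by rewrite ler_wpM2l // mulr_ge0.
  apply: (partial_bound_lipschitz C00 _ zr) => z' j /Hr[Vz' dd].
  by split; [have [] := ddg i j z' Vz'|exact: dd].
have -> : g x - g x0 - dotp w (x - x0) = G x - G x0.
  by rewrite dotpDr dotpNr -[G x]/(g x - dotp w x) -[G x0]/(g x0 - dotp w x0); ring.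
apply: le_trans GL _; set D := dotp _ _.
rewrite [leLHS](_ : _ = N%:R * (N%:R * C0) * `|x - x0| ^+ 2); last by ring.
by rewrite ler_wpM2l ?mulr_ge0 // normr_le_enorm_sqr.
Unshelve. all: by end_near. Qed.

End Taylor.

(** * Tangent balls and contact points *)

Lemma defining_function_closure_le0 (R : realType) (N : nat)
    (Omega V : set 'rV[R]_N) (rho : 'rV[R]_N -> R) x :
  C2_defining_function Omega V rho -> V x -> closure Omega x -> rho x <= 0.
Proof.
move=> [oV [crho _ _] _ VO] Vx clx; rewrite leNgt; apply/negP => rx.
have /cvgrPdist_lt/(_ _ rx) near_rho := crho x Vx.
have [y [Oy [Vy]]] := clx _ (filterI (open_nbhs_nbhs (conj oV Vx)) near_rho).
have ry := (VO y Vy).1 Oy.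
by rewrite /= ltr_norml => /andP[_]; lra.
Qed.

(** By Taylor, rho is trapped between the quadrics <g, h> - C |h|^2 and
    <g, h> + C |h|^2 with h = x - x0; balls of radius t |g| with 1 / (2 t) > C,
    centred on either side of x0, lie locally on the good side of them. *)
Lemma tangent_balls (R : realType) (N : nat) (Omega V : set 'rV[R]_N)
    (rho : 'rV[R]_N -> R) x0 :
  open Omega -> C2_defining_function Omega V rho -> V x0 -> boundary Omega x0 ->
  let g := grad rho x0 in
  exists2 t, 0 < t & \forall x \near x0,
    (x != x0 ->
     dotp (x - (x0 - t *: g)) (x - (x0 - t *: g)) <=
       dotp (x0 - (x0 - t *: g)) (x0 - (x0 - t *: g)) -> Omega x) /\
    (closure Omega x ->
     dotp (x0 - (x0 + t *: g)) (x0 - (x0 + t *: g)) <=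
       dotp (x - (x0 + t *: g)) (x - (x0 + t *: g))).
Proof.
move=> oO def Vx0 [clx0 nOx0] g; have [oV C2rho _ VO] := def.
have rx0 : rho x0 = 0.
  apply/eqP; rewrite eq_le (defining_function_closure_le0 def Vx0 clx0) /=.
  rewrite leNgt; apply/negP => /(VO _ Vx0).2.
  by rewrite ((interior_id Omega).1 oO) in nOx0.
have [C C0 HC] := taylor_bound oV C2rho Vx0; rewrite -/g rx0 in HC.
exists (2 * (C + 1))^-1; first by rewrite invr_gt0; lra.
set t := _^-1; have t0 : 0 < t by rewrite invr_gt0; lra.
have tC : 2 * t * (C + 1) = 1 by rewrite /t; field; lra.
have nearV := open_nbhs_nbhs (conj oV Vx0).
apply: (filterS _ (filterI nearV HC)) => x [Vx].
rewrite subr0; set h := x - x0.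
have ein : x - (x0 - t *: g) = h + t *: g by rewrite opprB addrCA addrC.
have eex : x - (x0 + t *: g) = h - t *: g by rewrite opprD addrA.
have e0in : x0 - (x0 - t *: g) = t *: g by rewrite opprB addrC subrK.
have e0ex : x0 - (x0 + t *: g) = - (t *: g) by rewrite opprD addrA subrr sub0r.
rewrite ler_norml => /andP[lo up]; split.
  move=> xx0; rewrite ein e0in dotp_sqrD (dotpZr t h) gerDr => tang.
  apply/(VO _ Vx).2; have h0 : 0 < dotp h h by apply: dotp_gt0; rewrite subr_eq0.
  rewrite (dotpC h g) in tang.
  have : dotp h h * (2 * t * (C + 1)) + 2 * t * dotp g h <= 0.
    by rewrite tC; lra.
  rewrite [X in X <= 0](_ : _ = 2 * t * (dotp h h * (C + 1) + dotp g h));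
    last by ring.
  by rewrite pmulr_rle0 ?mulr_gt0 //; lra.
move=> clx; have rx := defining_function_closure_le0 def Vx clx.
rewrite eex e0ex dotp_sqrD !dotpNr !dotpNl !opprK (dotpZr t h) -lerBlDr subrr.
rewrite (dotpC h g).
have h0 : 0 <= dotp h h by exact: dotp_ge0.
have : 0 <= 2 * t * (dotp h h * (C + 1) - dotp g h).
  by rewrite mulr_ge0 //; nra.
rewrite [X in 0 <= X](_ : _ = dotp h h * (2 * t * (C + 1)) - 2 * t * dotp g h);
  last by ring.
by rewrite tC; lra.
Qed.

Lemma operator_continuous_zero_jet (R : realType) (N : nat)
    (Omega : set 'rV[R]_N) (F : operator R N) (r e : R) x :
  operator_continuous Omega F -> closure Omega x -> 0 < e ->
  \forall x' \near x, closure Omega x' -> `|F x r 0 0 - F x' r 0 0| < e.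
Proof.
move=> /subspace_continuousP cF clx e0.
have sym0 := symmetricmx0 R N.
have := cF (x, r, 0, 0) (conj clx sym0).
move=> /cvgrPdist_lt/(_ e e0); rewrite near_withinE => near_F.
pose j (x' : 'rV[R]_N) := (x', r, 0 : 'rV[R]_N, 0 : 'M[R]_N).
have c1 : (fun x' : 'rV[R]_N => (x', r)) @ x --> (x, r).
  exact: (@cvg_pair _ _ _ (nbhs x) (nbhs x) (nbhs r) _ _ _ _ _
    cvg_id (cvg_cst r)).
have c2 : (fun x' : 'rV[R]_N => (x', r, 0 : 'rV[R]_N)) @ x
    --> (x, r, 0 : 'rV[R]_N).
  exact: (@cvg_pair _ _ _ (nbhs x) (nbhs (x, r)) (nbhs (0 : 'rV[R]_N))
    _ _ _ _ _ c1 (cvg_cst _)).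
have cj : j @ x --> j x.
  exact: (@cvg_pair _ _ _ (nbhs x) (nbhs (x, r, 0 : 'rV[R]_N))
    (nbhs (0 : 'M[R]_N)) _ _ _ _ _ c2 (cvg_cst _)).
have near_x : \forall x' \near x,
    closure Omega x' /\ (0 : 'M[R]_N) \is symmetricmx ->
    `|F x r 0 0 - F x' r 0 0| < e := cj _ near_F.
by move: near_x; apply: filterS => x' + clx'; apply.
Qed.

(** The sign s serves to transport both inequalities 0 <= F and F <= 0. *)
Lemma operator_closure_ge0 (R : realType) (N : nat) (Omega : set 'rV[R]_N)
    (F : operator R N) (r s : R) :
  operator_continuous Omega F ->
  (forall x, Omega x -> 0 <= s * F x r 0 0) ->
  forall x, closure Omega x -> 0 <= s * F x r 0 0.
Proof.
move=> cF F0 x clx; rewrite leNgt; apply/negP => Fx.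
have s0 : s != 0 by apply: contraTneq Fx => ->; rewrite mul0r ltxx.
have e0 : 0 < - (s * F x r 0 0) / `|s|.
  by rewrite divr_gt0 ?normr_gt0 // oppr_gt0.
have [y [Oy]] := clx _ (operator_continuous_zero_jet r cF clx e0).
move=> /(_ (subset_closure Oy)); rewrite ltr_pdivlMr ?normr_gt0 //.
rewrite -normrM mulrBl ltr_norml => /andP[lo _].
by have := F0 y Oy; move: lo; rewrite !(mulrC s); lra.
Qed.

Lemma closed_contact_set (R : realType) (N : nat) (K : set 'rV[R]_N)
    (u : 'rV[R]_N -> R) (M : R) :
  closed K -> usc_on K u -> (forall x, K x -> u x <= M) ->
  closed [set x | K x /\ u x = M].
Proof.
move=> cK uK uM x clx.
have Kx : K x by apply: cK; apply: closureS clx => y [].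
split=> //; apply/eqP; rewrite eq_le uM //= leNgt; apply/negP => xM.
by have [y [[Ky yM] /(_ Ky)]] := clx _ (uK _ Kx _ xM); rewrite yM ltxx.
Qed.

(** Take y0 outside Z very close to z, and x0 a point of Z closest to y0: it is
    still in U. The open ball of centre y0 through x0 avoids Z, and halving its
    radius, with x0 kept on the sphere, leaves x0 as only contact point. *)
Lemma contact_at_closest_point (R : realType) (N : nat) (Z U : set 'rV[R]_N) z :
  compact Z -> Z z -> open U -> U z -> ~ nbhs z Z ->
  exists x0 y, [/\ Z x0, U x0, x0 != y & forall x, Z x -> x != x0 ->
    dotp (x0 - y) (x0 - y) < dotp (x - y) (x - y)].
Proof.
move=> cZ Zz oU Uz nZ.
have [e e0 He] := subset_near_closed_ball (open_nbhs_nbhs (conj oU Uz)).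
have e2 : 0 < e / 2 by rewrite divr_gt0.
have [y0 [nZy0 zy0]] : exists y0, ~ Z y0 /\ dotp (y0 - z) (y0 - z) <= (e / 2) ^+ 2.
  apply: contrapT => noy; apply: nZ.
  have := @near_sphere_fun R N z z ((e / 2) ^+ 2) (exprn_gt0 2 e2).
  apply: filterS => y; rewrite /sphere_fun subrr {2}/dotp.
  rewrite big1 ?subr0 ?ger0_norm ?dotp_ge0 // => [yz|i _]; last by rewrite mxE mul0r.
  by apply: contrapT => nZy; apply: noy; exists y.
have [x0 Zx0 closest] : exists2 x0, Z x0 &
    forall x, Z x -> dotp (x0 - y0) (x0 - y0) <= dotp (x - y0) (x - y0).
  have [|||x0 Zx0 max_x0] := @usc_on_max R N Z (fun x => 0 - sphere_fun y0 0 x).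
  - exact: cZ.
  - by exists z.
  - apply: usc_on_subr; last exact: continuous_sphere_fun.
    by move=> x _ t xt; apply: filterE => y.
  by exists x0 => // x /max_x0; rewrite /sphere_fun; lra.
have le_e2 v : dotp v v <= (e / 2) ^+ 2 -> `|v| <= e / 2.
  move=> ve; rewrite -(@ler_pXn2r _ 2) ?nnegrE ?normr_ge0 ?(ltW e2) //.
  exact: le_trans (normr_le_enorm_sqr v) ve.
have w0 : x0 != y0 by apply/eqP => xy; apply: nZy0; rewrite -xy.
have Ux0 : U x0.
  apply: He; rewrite -(subrK y0 x0) -addrA (le_trans (ler_normD _ _)) //.
  rewrite [leRHS](splitr e) lerD ?le_e2 //.
  apply: le_trans zy0; apply: le_trans (closest z Zz) _.
  by rewrite -opprB dotpNl dotpNr opprK.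
exists x0, (x0 - 2^-1 *: (x0 - y0)); split=> //.
  by rewrite eq_sym subr_eq addrC -subr_eq subrr eq_sym scaler_eq0 invr_eq0 subr_eq0
    negb_or pnatr_eq0.
move=> x Zx xx0; set w := x0 - y0 in closest *.
have -> : x0 - (x0 - 2^-1 *: w) = 2^-1 *: w by rewrite opprB addrC subrK.
have -> : x - (x0 - 2^-1 *: w) = (x - x0) + 2^-1 *: w.
  by rewrite opprB addrCA addrC.
have h0 : 0 < dotp (x - x0) (x - x0) by apply: dotp_gt0; rewrite subr_eq0.
have := closest x Zx; have -> : x - y0 = (x - x0) + w by rewrite addrA subrK.
by move: (x - x0) h0 => h h0; rewrite !dotp_sqrD (dotpZr _ h); lra.
Qed.

(** * Strong maximum principle *)

Section StrongMaximumPrinciple.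
Context (R : realType) (m : nat).
Context (a A : R) (Omega : set 'rV[R]_m.+1) (F : operator R m.+1)
  (n : 'rV[R]_m.+1 -> 'rV[R]_m.+1) (f : 'rV[R]_m.+1 -> R -> R)
  (u : 'rV[R]_m.+1 -> R).
Hypotheses (a_gt0 : 0 < a) (a_le_A : a <= A).
Hypotheses (Omega_open : open Omega) (Omega_bounded : bounded_set Omega).
Hypothesis (F_pucci : pucci_structure a A Omega F).
Hypothesis (F_ge0 : forall x r, closure Omega x -> 0 <= r -> 0 <= F x r 0 0).
Hypothesis (f_ge0 : forall x r, boundary Omega x -> 0 <= r -> 0 <= f x r).
Hypothesis (u_sub : viscosity_subsolution Omega F
  (fun x r p => f x r + dotp p (n x)) u).

Lemma closure_interior_or_boundary x :
  closure Omega x -> Omega x \/ boundary Omega x.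
Proof.
move=> clx; have [|nx] := pselect (Omega x); [by left|right; split=> //].
by rewrite ((interior_id Omega).1 Omega_open).
Qed.

(** Hopf's argument, at an interior as well as at a boundary point. Let phi be
    the barrier of the sphere of centre y through x0, and maximize u - phi over
    the closure near x0. On the edge of this neighbourhood the value M at x0 is
    not reached: outside the ball phi is positive, and on the compact part inside
    the ball u stays below some M' < M, which leaves room for a small d. The
    maximum is thus a local one, and the strict inequality for F there rules out
    points of Omega. As the maximum point lies in the closed ball, which meets the
    boundary at most at x0, it can only be x0; there the normal derivative of phi
    is positive too, so that the boundary condition fails as well. *)
Lemma no_max_at_tangent_ball (M : R) x0 y :
  0 < M -> (forall x, closure Omega x -> u x <= M) ->
  closure Omega x0 -> u x0 = M -> x0 != y ->
  (\forall x \near x0, closure Omega x -> x != x0 ->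
     dotp (x - y) (x - y) <= dotp (x0 - y) (x0 - y) -> Omega x /\ u x < M) ->
  (boundary Omega x0 -> 0 < dotp (x0 - y) (n x0)) -> False.
Proof.
move=> M0 uM clx0 ux0 x0y touch normal; have [u_usc u_visc] := u_sub.
have [K [K0 HK]] := strict_barrier a_gt0 a_le_A F_pucci x0y.
pose E := dotp (x0 - y) (x0 - y); rewrite -/E in touch HK.
have E0 : 0 < E by apply: dotp_gt0; rewrite subr_eq0.
pose q := sphere_fun y E.
have qx0 : q x0 = 0 by exact: sphere_fun_center.
have [r r0 Hr] := subset_near_closed_ball (filterI touch HK).
pose C := closure Omega `&` [set x | `|x - x0| <= r].
have cC : compact C.
  apply: compact_closedI; first exact: compact_closure.
  exact: closed_ball_closed.
have Cx0 : C x0 by split=> //=; rewrite subrr normr0 ltW.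
have [M' [M'0 M'M uM']] : exists M', [/\ 0 <= M', M' < M &
    forall x, C x -> r <= `|x - x0| -> q x <= 0 -> u x <= M'].
  pose S := C `&` (~` [set x | `|x - x0| < r] `&` [set x | q x <= 0]).
  have cS : compact S.
    apply: compact_closedI => //; apply: closedI.
      apply: open_closedC.
      rewrite (_ : mkset _ = ball x0 r); first exact: ball_open.
      by apply/seteqP; split=> x; rewrite mx_norm_ball /ball_ /= distrC.
    apply: (@closed_comp _ _ q [set t | t <= 0]); last exact: closed_le.
    by move=> x _; exact: continuous_sphere_fun.
  have [S0|S0] := pselect (S !=set0); last first.
    exists 0; split=> // x Cx rx qx; exfalso; apply: S0; exists x.
    by split=> //; split=> //=; apply/negP; rewrite -leNgt.
  have [|x [[clx xr] [/negP xr' qx]] max_x] := usc_on_max cS S0 (u := u).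
    by apply: usc_on_subset u_usc => x [[]].
  exists (Num.max 0 (u x)); split; first by rewrite le_max lexx.
    rewrite gt_max M0 /=; rewrite -leNgt in xr'.
    have [/(_ clx) + _] := Hr _ xr; move=> [||_ //].
    - apply/eqP => xx0; move: xr'; rewrite xx0 subrr normr0.
      by rewrite leNgt r0.
    - by move: qx; rewrite /= /q /sphere_fun subr_le0.
  move=> z Cz rz qz; rewrite le_max; apply/orP; right; apply: max_x.
  by split=> //; split=> //=; apply/negP; rewrite -leNgt.
(* As |K q| <= 1 / 4, this choice gives phi >= - 5/16 (M - M'). *)
pose d := K * (M - M').
have d0 : 0 < d by rewrite mulr_gt0 // subr_gt0.
pose phi := barrier y E d K.
have phix0 : phi x0 = 0 by rewrite /phi /barrier -/(q x0) qx0; ring.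
have phi_ge x : `|x - x0| <= r -> - (M - M') / 2 <= phi x.
  move=> /Hr[_ [Kq _]]; rewrite -/(q x) in Kq.
  rewrite /phi /barrier -/(q x) /d.
  have : `|K * q x| <= 4^-1 by rewrite normrM gtr0_norm.
  rewrite ler_norml => /andP[k1 k2].
  have -> : K * (M - M') * (q x - K * q x ^+ 2)
    = (M - M') * (K * q x - (K * q x) ^+ 2) by ring.
  have : 0 < M - M' by rewrite subr_gt0.
  move: (M - M') (K * q x) k1 k2 => z k k1 k2 z0.
  have : - 2^-1 <= k - k ^+ 2 by nra.
  by rewrite -(ler_pM2l z0); lra.
have phi_gt0 x : `|x - x0| <= r -> 0 < q x -> 0 < phi x.
  move=> /Hr[_ [Kq _]] qx; rewrite -/(q x) gtr0_norm // in Kq.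
  rewrite /phi /barrier -/(q x) mulr_gt0 //.
  have -> : q x - K * q x ^+ 2 = q x * (1 - K * q x) by ring.
  by rewrite mulr_gt0 // subr_gt0 (le_lt_trans Kq) // invf_lt1 // ltr1n.
have [z [clz zr] max_z] : exists2 z, C z &
    forall x, C x -> u x - phi x <= u z - phi z.
  apply: usc_on_max => //; first by exists x0.
  apply: usc_on_subr; last exact: continuous_barrier.
  by apply: usc_on_subset u_usc => x [].
have Mz : M + phi z <= u z.
  by have := max_z _ Cx0; rewrite ux0 phix0; lra.
have qz : q z <= 0.
  rewrite leNgt; apply/negP => /(phi_gt0 _ zr); have := uM _ clz.
  by move: Mz; lra.
have zr' : `|z - x0| < r.
  rewrite ltNge; apply/negP => rz.
  have := uM' z (conj clz zr) rz qz; have := phi_ge _ zr.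
  by move: Mz M'M; lra.
have uz0 : 0 < u z.
  apply: lt_le_trans Mz; have := phi_ge _ zr.
  by move: M'M M'0; lra.
have loc_max : local_max_on (closure Omega) (fun x => u x - phi x) z.
  split=> //; rewrite near_withinE.
  have zb : open_nbhs z (ball x0 r).
    by split; [exact: ball_open|rewrite mx_norm_ball /ball_ /= distrC].
  have := open_nbhs_nbhs zb; apply: filterS => x.
  rewrite mx_norm_ball /ball_ /= distrC => xr clx.
  by apply: max_z; split=> //=; exact: ltW.
have [visc_in visc_bd] := u_visc phi z (C2_barrier Omega y E d K) loc_max.
have [Hz [_ Fz]] := Hr _ zr.
have Fpos := le_lt_trans (F_ge0 clz (ltW uz0)) (Fz d (u z) d0 clz).
rewrite -/phi in Fpos.
have [/visc_in|bdz] := closure_interior_or_boundary clz.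
  by rewrite leNgt Fpos.
have zx0 : z = x0.
  apply: contrapT => /eqP zx0; have [] := Hz clz zx0.
    by move: qz; rewrite /q /sphere_fun subr_le0.
  by have [_ nOz] := bdz; rewrite ((interior_id Omega).1 Omega_open) in nOz.
have := visc_bd bdz; rewrite ge_min leNgt Fpos /= leNgt ltr_wpDl //.
  exact: f_ge0 (ltW uz0).
rewrite /phi grad_barrier dotpZl -/(q z) zx0 qx0 mulr0 subr0 mulr1.
apply: mulr_gt0; first exact: mulr_gt0.
by apply: normal; rewrite -zx0.
Qed.

(** Otherwise some ball inside the set where u < M would touch the contact set
    at an interior point of Omega. *)
Lemma interior_contact (M : R) z :
  0 < M -> (forall x, closure Omega x -> u x <= M) -> Omega z -> u z = M ->
  nbhs z [set x | closure Omega x /\ u x = M].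
Proof.
move=> M0 uM Oz uz; set Z := [set x | _]; apply: contrapT => nZ.
have clZ : closed Z by apply: closed_contact_set u_sub.1 uM; exact: closed_closure.
have cZ : compact Z.
  by apply: subclosed_compact clZ (compact_closure Omega_bounded) _ => x [].
have Zz : Z z by split=> //; exact: subset_closure.
have [x0 [y [[clx0 ux0] Ox0 x0y sep]]] :=
  contact_at_closest_point cZ Zz Omega_open Oz nZ.
apply: (no_max_at_tangent_ball M0 uM clx0 ux0 x0y).
  have near_O := open_nbhs_nbhs (conj Omega_open Ox0).
  near=> x => clx xx0 xy; split; first by near: x.
  rewrite lt_neqAle uM // andbT; apply/eqP => ux.
  by have := sep x (conj clx ux) xx0; rewrite ltNge xy.
by case=> _; rewrite ((interior_id Omega).1 Omega_open).
Unshelve. all: by end_near. Qed.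

(** Otherwise u < M in Omega and the interior tangent ball at x is a ball where
    u < M; its radius at x points along the exterior normal, as Hopf's argument
    requires. *)
Lemma interior_max_exists (M : R) x :
  (forall x, boundary Omega x -> exists V rho, [/\ V x,
     C2_defining_function Omega V rho
   & n x = (enorm (grad rho x))^-1 *: grad rho x]) ->
  0 < M -> (forall x, closure Omega x -> u x <= M) -> closure Omega x -> u x = M ->
  exists2 z, Omega z & u z = M.
Proof.
move=> n_normal M0 uM clx ux.
have [Ox|bdx] := closure_interior_or_boundary clx; first by exists x.
apply: contrapT => noz; have [V [rho [Vx def nx]]] := n_normal x bdx.
have gN0 : grad rho x != 0 by case: def => _ _ + _; apply.
have g0 := dotp_gt0 gN0.
have [t t0 near_t] := tangent_balls Omega_open def Vx bdx.
set g := grad rho x in gN0 g0 nx near_t.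
have xy : x - (x - t *: g) = t *: g by rewrite opprB addrC subrK.
apply: (no_max_at_tangent_ball M0 uM clx ux (y := x - t *: g)).
- by rewrite -subr_eq0 xy scaler_eq0 gt_eqF.
- apply: filterS near_t => z [tan_in _] clz zx zy.
  have Oz := tan_in zx zy; split=> //; rewrite lt_neqAle uM // andbT.
  by apply/eqP => uz; apply: noz; exists z.
- move=> _; rewrite xy nx dotpZl dotpZr !mulr_gt0 ?invr_gt0 //.
  by rewrite sqrtr_gt0.
Qed.

(** A barrier with d = 0 serves as constant test function. *)
Lemma barrier_flat (y x : 'rV[R]_m.+1) (E K : R) :
  [/\ barrier y E 0 K x = 0, grad (barrier y E 0 K) x = 0
    & hess (barrier y E 0 K) x = 0].
Proof.
split; first by rewrite /barrier mul0r.
- by rewrite grad_barrier mulr0 mul0r scale0r.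
- by rewrite hess_barrier !mulr0 !mul0r raddf0 scale0r subr0.
Qed.

Lemma constant_subsolution_operator_le0 (M : R) x :
  (forall x, closure Omega x -> u x = M) -> Omega x -> F x M 0 0 <= 0.
Proof.
move=> uM Ox; have clx := subset_closure Ox.
have loc_max : local_max_on (closure Omega) (fun z => u z - barrier x 0 0 0 z) x.
  split=> //; rewrite near_withinE; apply: filterE => z clz.
  have [-> _ _] := barrier_flat x z 0 0; have [-> _ _] := barrier_flat x x 0 0.
  by rewrite !uM.
have [visc _] := u_sub.2 _ _ (C2_barrier Omega x 0 0 0) loc_max.
by have := visc Ox; have [_ -> ->] := barrier_flat x x 0 0; rewrite uM.
Qed.

(** For constant u, the barrier of the exterior tangent ball is a test function
    at x, since it is nonnegative on the closure and vanishes at x. It makes F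
    positive, while its gradient, of order d, is too small to compensate for
    f x M > 0. *)
Lemma constant_subsolution_boundary_le0 (M : R) x V rho :
  0 < M -> (forall x, closure Omega x -> u x = M) -> boundary Omega x -> V x ->
  C2_defining_function Omega V rho -> f x M <= 0.
Proof.
move=> M0 uM bdx Vx def; rewrite leNgt; apply/negP => fx; have [clx _] := bdx.
have g0 : grad rho x != 0 by case: def => _ _ + _; apply.
have [t t0 near_t] := tangent_balls Omega_open def Vx bdx.
set y := x + t *: grad rho x in near_t.
have xy : x != y.
  by rewrite -subr_eq0 opprD addrA subrr sub0r oppr_eq0 scaler_eq0 gt_eqF.
have [K [K0 near_K]] := strict_barrier a_gt0 a_le_A F_pucci xy.
set E := dotp (x - y) (x - y) in near_K.
have qx : sphere_fun y E x = 0 by exact: sphere_fun_center.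
set D := dotp (x - y) (n x).
pose d := f x M / (2 * `|D| + 1).
have D1 : 0 < 2 * `|D| + 1 by rewrite ltr_wpDl // mulr_ge0.
have d0 : 0 < d by rewrite divr_gt0.
have loc_max : local_max_on (closure Omega) (fun z => u z - barrier y E d K z) x.
  split=> //; rewrite near_withinE.
  apply: (filterS _ (filterI near_t near_K)) => z [[_ tan_out] [Kq _]] clz.
  have qz : 0 <= sphere_fun y E z by rewrite subr_ge0 tan_out.
  rewrite ger0_norm // in Kq; rewrite !uM // lerB //.
  have -> : barrier y E d K x = 0 by rewrite /barrier qx; ring.
  have -> : barrier y E d K z
      = d * (sphere_fun y E z * (1 - K * sphere_fun y E z)).
    by rewrite /barrier; ring.
  apply: mulr_ge0; first exact: ltW.
  apply: mulr_ge0 => //; rewrite subr_ge0 (le_trans Kq) //.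
  by rewrite invf_le1 // ler1n.
have [_ visc] := u_sub.2 _ _ (C2_barrier Omega y E d K) loc_max.
have [_ Fx] := nbhs_singleton near_K.
have := visc bdx; rewrite uM // ge_min leNgt.
rewrite (le_lt_trans (F_ge0 clx (ltW M0)) (Fx d M d0 clx)) /= leNgt.
rewrite grad_barrier qx mulr0 subr0 mulr1 dotpZl -/D.
have -> : 0 < f x M + 2 * d * D; last by [].
have : 2 * d * `|D| < f x M.
  have -> : f x M = 2 * d * `|D| + d by rewrite /d; field; rewrite gt_eqF.
  by rewrite ltrDl.
have Dle := ler_norm (- D); rewrite normrN in Dle.
by have := ler_wpM2l (ltW d0) Dle; lra.
Qed.

End StrongMaximumPrinciple.

(** * Maximum principle for subsolutions *)

Lemma sup_gt0_ex (R : realType) (A : set R) : 0 < sup A -> exists2 x, A x & 0 < x.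
Proof.
move=> supA; apply: contrapT => noA; have [A0|/set0P A0] := eqVneq A set0.
  by rewrite A0 sup0 ltxx in supA.
suff : sup A <= 0 by rewrite leNgt supA.
apply: ge_sup => // x Ax; rewrite leNgt; apply/negP => x0.
by apply: noA; exists x.
Qed.

Theorem theorem4p1 (R : realType) (N : nat) (N_gt0 : (0 < N)%N)
  (Omega : set 'rV[R]_N) (Omega_dom : bounded_C2_domain Omega)
  (n : 'rV[R]_N -> 'rV[R]_N)
  (n_normal : forall x, boundary Omega x -> exterior_unit_normal Omega x (n x))
  (a A : R) (a_gt0 : 0 < a) (a_le_A : a <= A)
  (F : operator R N) (F_cont : operator_continuous Omega F)
  (F_pucci : pucci_structure a A Omega F)
  (F_xreg : x_regularity Omega F)
  (f : 'rV[R]_N -> R -> R)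
  (f_cont : {within [set z : 'rV[R]_N * R | boundary Omega z.1],
             continuous (fun z : 'rV[R]_N * R => f z.1 z.2)})
  (f_mono : forall x, boundary Omega x ->
     forall r s : R, r <= s -> f x r <= f x s)
  (F_mono : forall (x p : 'rV[R]_N) (M : 'M[R]_N),
     closure Omega x -> M \is symmetricmx ->
     forall r s : R, r <= s -> F x r p M <= F x s p M)
  (F_ge0 : forall x, Omega x -> 0 <= F x 0 0 0)
  (f_ge0 : forall x, boundary Omega x -> 0 <= f x 0)
  (* both suprema are maxima: they are taken over nonempty compact sets *)
  (max_gt0 : forall r : R, 0 < r ->
     0 < Num.max (sup [set f x r | x in boundary Omega])
                 (sup [set F x r 0 0 | x in closure Omega]))
  (u : 'rV[R]_N -> R)
  (u_sub : viscosity_subsolution Omega F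
     (fun x r p => f x r + dotp p (n x)) u) :
  forall x, closure Omega x -> u x <= 0.
Proof.
clear F_xreg f_cont.
case: N N_gt0 Omega Omega_dom n n_normal F F_cont F_pucci f f_mono F_mono F_ge0
  f_ge0 max_gt0 u u_sub => // m _ Omega [[x1 Ox1] oO conO bO _] n n_normal
  F F_cont F_pucci f f_mono F_mono F_ge0 f_ge0 max_gt0 u u_sub.
have sym0 := symmetricmx0 R m.+1.
have F_ge0' x r : closure Omega x -> 0 <= r -> 0 <= F x r 0 0.
  move=> clx r0; apply: le_trans (F_mono x 0 0 clx sym0 0 r r0).
  rewrite -[F x _ _ _]mul1r; apply: (operator_closure_ge0 F_cont) clx.
  by move=> z Oz; rewrite mul1r F_ge0.
have f_ge0' x r : boundary Omega x -> 0 <= r -> 0 <= f x r.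
  by move=> bx r0; apply: le_trans (f_mono x bx 0 r r0); exact: f_ge0.
have [xM clxM uM] : exists2 z, closure Omega z &
    forall x, closure Omega x -> u x <= u z.
  apply: usc_on_max; [exact: compact_closure| |exact: u_sub.1].
  by exists x1; exact: subset_closure.
move=> x clx; rewrite leNgt; apply/negP => ux.
set M := u xM in uM.
have M0 : 0 < M by apply: lt_le_trans (uM x clx).
have [z Oz uz] := interior_max_exists a_gt0 a_le_A oO bO F_pucci F_ge0' f_ge0'
  u_sub n_normal M0 uM clxM erefl.
pose Z := [set x | closure Omega x /\ u x = M].
have cZ : closed Z by apply: closed_contact_set u_sub.1 uM; exact: closed_closure.
have OZ : Omega `&` Z = Omega.
  apply: conO; first by exists z; split=> //; split=> //; exact: subset_closure.
    exists (interior Z); first exact: open_interior.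
    apply/seteqP; split=> w [Ow Zw]; split=> //; last exact: interior_subset Zw.
    exact: (interior_contact a_gt0 a_le_A oO bO F_pucci F_ge0' f_ge0' u_sub
      M0 uM Ow Zw.2).
  by exists Z.
have u_const w : closure Omega w -> u w = M.
  move=> clw; have : closure Z w by apply: closureS clw; rewrite -OZ => ? [].
  by rewrite -(closure_id Z).1 // => -[].
have := max_gt0 M M0; rewrite lt_max => /orP[] /sup_gt0_ex[_ [w Hw <-]].
  have [V [rho [Vw def _]]] := n_normal w Hw.
  by rewrite ltNge (constant_subsolution_boundary_le0 a_gt0 a_le_A oO F_pucci
    F_ge0' u_sub M0 u_const Hw Vw def).
have F_le0 y : Omega y -> 0 <= -1 * F y M 0 0.
  move=> Oy; rewrite mulN1r oppr_ge0.
  exact: (constant_subsolution_operator_le0 u_sub u_const Oy).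
have := operator_closure_ge0 F_cont F_le0 Hw.
by rewrite mulN1r oppr_ge0 leNgt => /negP.
Qed.
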